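(* Let $\epsilon>0$ and let $u^\epsilon$ be a solution to the viscous Hamilton–Jacobi equation $$\frac{\partial}{\partial\lambda}u^\epsilon+\frac12\|\nabla_x u^\epsilon\|^2=\frac{\epsilon}{2}\Delta_x u^\epsilon\ \text{ in }\mathbb{R}^N\times(0,\Lambda],\qquad u^\epsilon(x,0)=\phi(x)\ \text{ on }\mathbb{R}^N\times\{0\}.$$ Assume that $\inf u^\epsilon>-\infty$. Then for all $\lambda\in(0,\Lambda]$, $$\forall x\in\mathbb{R}^N,\quad D_x^2(u^\epsilon)(x,\lambda)\preceq\frac1\lambda\,\mathrm{Id} .$$
   Context: Here $\Lambda>0$, and $\phi:\mathbb{R}^N\to\mathbb{R}$ is the initial datum. $D_x^2$ denotes the Hessian in the variable $x$, $\Delta_x$ the Laplacian in $x$, and $\preceq$ is the Loewner order on symmetric matrices. The infimum of $u^\epsilon$ is over its space-time domain. *)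

(* Defs.v *)
From HB Require Import structures.
From mathcomp Require Import all_boot all_order all_algebra.
From mathcomp Require Import all_classical all_reals all_analysis.

Set Implicit Arguments.
Unset Strict Implicit.
Unset Printing Implicit Defensive.

Import Order.TTheory GRing.Theory Num.Theory.
Import numFieldNormedType.Exports.

Local Open Scope classical_set_scope.
Local Open Scope ring_scope.

Section SpaceDerivatives.
Variables (R : realType) (N : nat).
Implicit Types (f : 'rV[R]_N -> R) (x : 'rV[R]_N) (i j : 'I_N).

Definition std_basis i : 'rV[R]_N := delta_mx 0 i.

Definition partial i f x : R := 'D_(std_basis i) f x.

Definition grad f x : 'rV[R]_N := \row_i partial i f x.

Definition hessian f x : 'M[R]_N := \matrix_(i, j) partial i (partial j f) x.

Definition laplacian f x : R := \sum_i partial i (partial i f) x.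

(* The library norm `|v| on row vectors is the sup norm, so the Euclidean one
   is spelled out. *)
Definition sqnorm2 (v : 'rV[R]_N) : R := \sum_i v 0 i ^+ 2.

Definition loewner_le (A B : 'M[R]_N) : Prop :=
  [/\ A \is symmetricmx, B \is symmetricmx &
      forall v : 'rV[R]_N, 0 <= (v *m (B - A) *m v^T) 0 0].

End SpaceDerivatives.

Section TimeDerivative.
Variable R : realType.
Implicit Types (D : set R) (g : R -> R) (t : R).

(* Derivatives relative to D: for D = `]0, Lam] this is the usual derivative at
   t < Lam and the left derivative at t = Lam. *)
Definition diff_quotient g t : R -> R := fun s => (g s - g t) / (s - t).

Definition derivable_in D g t : Prop := cvg (diff_quotient g t @ within D t^').

Definition derive_in D g t : R := lim (diff_quotient g t @ within D t^').

End TimeDerivative.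

Section Solutions.
Variables (R : realType) (N : nat).
Implicit Types (u : 'rV[R]_N -> R -> R) (Lam eps : R).

Definition parabolic_dom Lam : set ('rV[R]_N * R) := setT `*` `]0, Lam].

Definition closed_parabolic_dom Lam : set ('rV[R]_N * R) := setT `*` `[0, Lam].

Definition time_deriv Lam u x t : R := derive_in `]0, Lam] (u x) t.

(* Class C^{2,1} on R^N x ]0, Lam]. *)
Record C21 Lam u : Prop := {
  C21_dt : forall x t, t \in `]0, Lam] -> derivable_in `]0, Lam] (u x) t ;
  C21_dt_cont : {within parabolic_dom Lam,
    continuous (fun p => time_deriv Lam u p.1 p.2)} ;
  C21_dx : forall i x t, t \in `]0, Lam] -> derivable (u^~ t) x (std_basis R i) ;
  C21_dx_cont : forall i, {within parabolic_dom Lam,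
    continuous (fun p => partial i (u^~ p.2) p.1)} ;
  C21_dxx : forall i j x t, t \in `]0, Lam] ->
    derivable (partial j (u^~ t)) x (std_basis R i) ;
  C21_dxx_cont : forall i j, {within parabolic_dom Lam,
    continuous (fun p => partial i (partial j (u^~ p.2)) p.1)}
}.

(* Classical solution: C^{2,1} on R^N x ]0, Lam] and continuous up to the
   initial time.  Values u x t for t outside `[0, Lam] are irrelevant. *)
Record viscous_HJ_solution eps Lam (phi : 'rV[R]_N -> R) u : Prop := {
  vHJ_C21 : C21 Lam u ;
  vHJ_cont : {within closed_parabolic_dom Lam,
    continuous (fun p => u p.1 p.2)} ;
  vHJ_eq : forall x t, t \in `]0, Lam] ->
    time_deriv Lam u x t + 2^-1 * sqnorm2 (grad (u^~ t) x)
      = eps / 2 * laplacian (u^~ t) x ;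
  vHJ_init : forall x, u x 0 = phi x
}.

Definition inf_on_dom Lam u : \bar R :=
  ereal_inf [set (u p.1 p.2)%:E | p in closed_parabolic_dom Lam].

End Solutions.

(* Main.v *)
Require Import Defs.
From mathcomp Require Import all_boot all_order all_algebra.
From mathcomp Require Import all_classical all_reals all_analysis.
From mathcomp Require Import ring lra.
Import Order.TTheory GRing.Theory Num.Theory.
Import numFieldNormedType.Exports.
Local Open Scope classical_set_scope.
Local Open Scope ring_scope.

(** Why the theorem is true.  By the Hopf-Cole substitution
    [v = expR (- u / eps)] is a bounded positive solution of the heat equation
    [v_t = eps / 2 * Laplacian v].  That equation is invariant under Galilean
    boosts: for every velocity [c],
    [V_c (x, t) = expR ((c.x + t * |c|^2 / 2) / eps) * v (x + t *: c, t)]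
    is again a solution (lemma [boost_heat]).  At time [0] it equals
    [expR (c.x / eps) * v (x, 0)], so for every weight [l > 0] the solution
    [l * V_c + V_(-c) / l - 2 * V_0] is nonnegative initially, by the
    arithmetic-geometric mean inequality; it is bounded below by
    [- 2 * sup v], which is finite because [u] is bounded below.  A minimum
    principle on the whole space ([heat_min_principle]) keeps it nonnegative at
    all later times ([boost_pair_ge]).  Choosing [l] so that the first two terms
    agree at the given point, and taking logarithms with [c = z / t], gives
    [u (x + z, t) + u (x - z, t) - 2 * u (x, t) <= |z|^2 / t]
    ([semiconcavity]).  Replacing [z] by [s *: z], dividing by [s ^+ 2] and letting
    [s] tend to [0] bounds the quadratic form of the Hessian by [|z|^2 / t].

    The minimum principle looks at the equation through difference quotients at a single
    minimum point, so the calculus comes down to computing limits of left time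
    quotients and of symmetric second differences.  The time quotients are taken
    along the moving points [x + t *: c]; a mean value inequality that uses
    only partial derivatives ([mean_value_box]) handles them, and also the
    directional derivatives in the quadratic form.  The symmetry of the Hessian,
    which the Loewner order requires, is Schwarz's theorem ([schwarz]). *)

Set Implicit Arguments.
Unset Strict Implicit.
Unset Printing Implicit Defensive.

(** * Second differences and left derivatives in one variable *)

Section OneVariable.
Variable R : realType.
Implicit Types (g : R -> R) (s t : R).

Definition second_quotient g : R -> R :=
  fun s => (g s + g (- s) - 2 * g 0) / s ^+ 2.

(** L'Hopital's rule reduces this to the symmetric difference quotient of [g1],
    whose limit exists as soon as [g1] is differentiable at [0]. *)
Lemma second_quotient_cvg g g1 (g2 : R) :
  (forall s, is_derive s 1 g (g1 s)) -> is_derive (0 : R) 1 g1 g2 ->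
  second_quotient g s @[s --> 0^'+] --> g2.
Proof.
move=> dg dg1.
pose num : R -> R := fun s => g s + g (- s) - 2 * g 0.
have dgN s : is_derive s 1 (fun s => g (- s)) (- g1 (- s)).
  by rewrite -mulrN1; apply: (is_derive1_comp (f := g) (g := -%R)).
have dnum s : is_derive s 1 num (g1 s - g1 (- s)).
  have -> : num = (g + (fun s => g (- s)) - cst (2 * g 0)) by [].
  by apply: is_derive_eq; rewrite subr0.
have dsq s : is_derive s 1 (fun s => s ^+ 2 : R) (2 * s).
  have -> : (fun s => s ^+ 2 : R) = id ^+ 2 by apply/funext => ?; rewrite !fctE.
  by apply: is_derive_eq; rewrite expr1 /GRing.scale/= mulr1.
have cvg_at0 (f : R -> R) df : is_derive (0 : R) 1 f df -> f 0 = 0 ->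
    f s @[s --> 0^'+] --> 0.
  move=> df0 f0; rewrite -[X in _ --> X]f0; apply: cvg_at_right_filter.
  have : {for (0 : R), continuous f}.
    by apply/differentiable_continuous/derivable1_diffP; exact: ex_derive.
  exact.
apply: (@lhopital_at_right R num (fun s => g1 s - g1 (- s)) (fun s => s ^+ 2)
  (fun s => 2 * s) 0 1) => //.
- by apply: cvg_at0; rewrite /num oppr0; lra.
- by apply: cvg_at0; rewrite expr0n.
- by move=> s /[!in_itv]/= /andP[s0 _]; lra.
have qcvg : (g1 s - g1 0) / s @[s --> 0^'] --> g2.
  have := @ex_derive _ _ _ _ _ _ _ dg1; rewrite /derivable => /= dq.
  have <- : 'D_1 g1 (0 : R) = g2 by rewrite derive_val.
  move: dq; apply: cvg_trans; apply: near_eq_cvg; near=> s.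
  by rewrite /GRing.scale/= mulr1 addr0 mulrC.
have qcvgN : (g1 0 - g1 (- s)) / s @[s --> 0^'+] --> g2.
  have /cvg_at_leftNP := cvg_dnbhs_at_left qcvg; rewrite oppr0.
  apply: cvg_trans; apply: near_eq_cvg; near=> s.
  by rewrite /= invrN mulrN -mulNr opprB.
have : 2^-1 * ((g1 s - g1 0) / s + (g1 0 - g1 (- s)) / s)
    @[s --> 0^'+] --> 2^-1 * (g2 + g2).
  apply: cvgM; first exact: cvg_cst.
  by apply: cvgD => //; exact: cvg_dnbhs_at_right.
have -> : 2^-1 * (g2 + g2) = g2 by lra.
apply: cvg_trans; apply: near_eq_cvg; near=> s.
have s0 : s != 0 by apply: lt0r_neq0; near: s; exact: nbhs_right_gt.
by field.
Unshelve. all: by end_near. Qed.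

Lemma second_quotient_cvg_expR g g1 (g2 : R) :
  (forall s, is_derive s 1 g (g1 s)) -> is_derive (0 : R) 1 g1 g2 ->
  second_quotient (expR \o g) s @[s --> 0^'+]
    --> expR (g 0) * (g2 + g1 0 ^+ 2).
Proof.
move=> dg dg1.
have deg s : is_derive s 1 (expR \o g) (expR (g s) * g1 s).
  by apply: is_derive1_comp.
apply: second_quotient_cvg deg _.
have -> : (fun s => expR (g s) * g1 s) = (expR \o g) * g1 by [].
apply: is_derive_eq; rewrite /GRing.scale/=; ring.
Qed.

(** A chain rule for one-sided derivatives: Caratheodory's factorization of
    [expR y - expR (g t)] turns it into a product of limits. *)
Lemma left_quotient_expR g t d :
  diff_quotient g t s @[s --> t^'-] --> d ->
  diff_quotient (expR \o g) t s @[s --> t^'-] --> expR (g t) * d.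
Proof.
move=> gd.
have /is_derive1_caratheodory[phi [expE phic phit]] := is_derive_expR (g t).
have gc : g s @[s --> t^'-] --> g t.
  have : (s - t) * diff_quotient g t s + g t @[s --> t^'-] --> 0 * d + g t.
    apply: cvgD; last exact: cvg_cst.
    apply: cvgM => //; rewrite -(subrr t); apply: cvgB; last exact: cvg_cst.
    exact: cvg_at_left_filter.
  rewrite mul0r add0r; apply: cvg_trans; apply: near_eq_cvg; near=> s.
  have st : s - t != 0 by rewrite subr_eq0; near: s; exact: nbhs_left_neq.
  by rewrite /diff_quotient mulrC divfK// subrK.
have : phi (g s) * diff_quotient g t s @[s --> t^'-] --> expR (g t) * d.
  apply: cvgM => //; rewrite -phit; exact: (cvg_comp g phi gc phic).
apply: cvg_trans; apply: near_eq_cvg; near=> s.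
by rewrite /diff_quotient/= expE mulrA.
Unshelve. all: by end_near. Qed.

(** The difference of the two sides is
    [expR b * (expR (k / 2) - expR (- k / 2)) ^+ 2]. *)
Lemma expR_pair_ge (b k : R) : 2 * expR b <= expR (b + k) + expR (b - k).
Proof.
have kE (r : R) : expR r = expR (r / 2) ^+ 2.
  by rewrite expr2 -expRD; congr expR; field.
rewrite -subr_ge0.
have -> : expR (b + k) + expR (b - k) - 2 * expR b
    = expR b * (expR (k / 2) - expR (- k / 2)) ^+ 2.
  have k1 : expR (k / 2) * expR (- k / 2) = 1.
    by rewrite -expRD mulNr subrr expR0.
  by rewrite sqrrB -!kE k1 !expRD; ring.
by rewrite mulr_ge0 ?expR_ge0// sqr_ge0.
Qed.

End OneVariable.

(** * Mean value theorems along lines and in boxes *)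

Section Lines.
Variables (R : realType) (N : nat).
Implicit Types (f : 'rV[R]_N -> R) (x y v : 'rV[R]_N).

Lemma is_derive_line f x v (s : R) : derivable f (x + s *: v) v ->
  is_derive s 1 (fun r => f (x + r *: v)) ('D_v f (x + s *: v)).
Proof.
have E : (fun h : R => h^-1 *: (((fun r => f (x + r *: v)) \o shift s) (h *: 1)
            - f (x + s *: v)))
       = (fun h => h^-1 *: ((f \o shift (x + s *: v)) (h *: v)
            - f (x + s *: v))).
  apply/funext => h /=; congr (_ *: (f _ - _)).
  by rewrite /GRing.scale/= mulr1 -/(GRing.scale _ _) scalerDl addrCA.
by move=> df; split; rewrite /derivable /derive E.
Qed.

(** Parametrizing the segment by [0, 1] rather than by its length avoids a case
    split on the sign of [d]. *)
Lemma mean_value_line f x v (d : R) : (forall y, derivable f y v) ->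
  exists2 th : R, 0 <= th <= 1 &
    f (x + d *: v) - f x = d * 'D_v f (x + (th * d) *: v).
Proof.
move=> df.
have dg (th : R) : is_derive th 1 (fun th : R => f (x + (th * d) *: v))
    ('D_v f (x + (th * d) *: v) * d).
  apply: (is_derive1_comp (f := fun r => f (x + r *: v)) (g := *%R^~ d)).
    exact: is_derive_line.
  have -> : *%R^~ d = d \*: (id : R -> R).
    by apply/funext => r; rewrite /GRing.scale/= mulrC.
  by apply: is_derive_eq; rewrite /GRing.scale/= mulr1.
have [th th01 E] := @MVT_segment R _ _ 0 1 ler01 (fun th _ => dg th)
  (derivable_within_continuous (fun th _ => @ex_derive _ _ _ _ _ _ _ (dg th))).
exists th; first by move: th01; rewrite in_itv.
by move: E; rewrite mul1r mul0r scale0r addr0 subr0 mulr1 mulrC.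
Qed.

Lemma normr_rV_le x (r : R) : 0 <= r ->
  (`|x| <= r) = [forall i, `|x 0 i| <= r].
Proof.
move=> r0; rewrite {1}/Num.norm /= mx_normrE.
apply/idP/forallP => [/bigmax_leP[_ h] i|h].
  exact: (h (0, i)).
by apply/bigmax_leP; split=> // -[i j] _ /=; rewrite (ord1 i).
Qed.

(** Going from [x] to [y] one coordinate at a time never leaves the box of
    radius [r] around [p], because the norm is the sup norm; on each edge the
    one-variable mean value theorem applies to a partial derivative. *)
Lemma mean_value_box f (a p : 'rV[R]_N) (r eta : R) : 0 <= r ->
  (forall i y, derivable f y (std_basis R i)) ->
  (forall i y, `|y - p| <= r -> `|partial i f y - a 0 i| <= eta) ->
  forall x y, `|x - p| <= r -> `|y - p| <= r ->
  `|f y - f x - \sum_i (y 0 i - x 0 i) * a 0 i|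
    <= eta * \sum_i `|y 0 i - x 0 i|.
Proof.
move=> r0 df dfa x y; rewrite !normr_rV_le// => /forallP xp /forallP yp.
pose P k : 'rV[R]_N := \row_j (if (j < k)%N then y 0 j else x 0 j).
have P0 : P 0 = x by apply/rowP => j; rewrite mxE.
have PN : P N = y by apply/rowP => j; rewrite mxE ltn_ord.
have -> : f y - f x = \sum_(i < N) (f (P i.+1) - f (P i)).
  by rewrite -{1}PN -{1}P0 -(telescope_sumr (f \o P)) // big_mkord.
rewrite -sumrB (le_trans (ler_norm_sum _ _ _))// mulr_sumr ler_sum// => i _.
set d := y 0 i - x 0 i.
have PS : P i.+1 = P i + d *: std_basis R i.
  apply/rowP => j; rewrite !mxE eqxx/= ltnS leq_eqVlt -(inj_eq val_inj).
  case: ltngtP => [_|_|/val_inj ->] /=; rewrite ?mulr0 ?addr0//.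
  by rewrite mulr1 /d addrCA subrr addr0.
have [th /andP[th0 th1] E] := mean_value_line (P i) d (df i); rewrite PS E.
rewrite -mulrBr normrM mulrC ler_wpM2r ?normr_ge0//; apply: dfa.
rewrite normr_rV_le//; apply/forallP => j; rewrite !mxE/=.
move: (xp j) (yp j); rewrite !mxE.
have [->|ij] := eqVneq j i; last by rewrite mulr0 addr0; case: ifP.
rewrite ltnn mulr1 !ler_norml => /andP[xl xr] /andP[yl yr].
have thE : th * d = th * (y 0 i) - th * (x 0 i) by rewrite mulrBr.
by apply/andP; split; rewrite thE; nra.
Qed.

End Lines.

(** * Continuous partial derivatives *)

Section Partials.
Variables (R : realType) (N : nat).
Implicit Types (f : 'rV[R]_N -> R) (x y v w : 'rV[R]_N).

(** The function and both end points may vary with [s] as long as the partial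
    derivatives stay uniformly close to [a] near [p].  Constant [f] and [y] give
    directional derivatives; [f s] equal to a solution at time [s] gives
    derivatives along moving points. *)
Lemma space_quotient_cvg {T : Type} {F : set_system T} {FF : Filter F}
    (f : T -> 'rV[R]_N -> R) (y : T -> 'rV[R]_N) (h : T -> R)
    (p v a : 'rV[R]_N) :
  (\forall s \near F, h s != 0) ->
  (\forall s \near F, forall i z, derivable (f s) z (std_basis R i)) ->
  (forall eta : R, 0 < eta -> exists2 r : R, 0 < r & \forall s \near F,
     forall i z, `|z - p| <= r -> `|partial i (f s) z - a 0 i| <= eta) ->
  y s @[s --> F] --> p -> y s + h s *: v @[s --> F] --> p ->
  (f s (y s + h s *: v) - f s (y s)) / h s @[s --> F] -->
    \sum_i v 0 i * a 0 i.
Proof.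
move=> h0 df da yp yhp; apply/cvgrPdistC_le => e e0.
have S0 : 0 <= \sum_i `|v 0 i| by apply: sumr_ge0.
have S1 : 0 < \sum_i `|v 0 i| + 1 by lra.
have [r r0 dar] := da _ (divr_gt0 e0 S1).
near=> s.
have hs : h s != 0 by near: s.
have -> : (f s (y s + h s *: v) - f s (y s)) / h s - \sum_i v 0 i * a 0 i
    = (f s (y s + h s *: v) - f s (y s)
       - \sum_i ((y s + h s *: v) 0 i - (y s) 0 i) * a 0 i) / h s.
  rewrite [RHS]mulrBl; congr (_ - _); rewrite mulr_suml; apply: eq_bigr => i _.
  by rewrite !mxE; field.
rewrite normrM normfV ler_pdivrMr ?normr_gt0//.
apply: (le_trans (mean_value_box (a := a) (p := p) (r := r)
  (eta := e / (\sum_i `|v 0 i| + 1)) _ _ _ _ _)).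
- exact: ltW.
- by near: s.
- by near: s.
- near: s; move/cvgrPdistC_le : yp; exact.
- near: s; move/cvgrPdistC_le : yhp; exact.
have -> : \sum_i `|(y s + h s *: v) 0 i - (y s) 0 i| = `|h s| * \sum_i `|v 0 i|.
  rewrite mulr_sumr; apply: eq_bigr => i _.
  by rewrite !mxE addrAC subrr add0r normrM.
rewrite mulrCA mulrC ler_wpM2r// mulrAC ler_pdivrMr// ler_wpM2l ?(ltW e0)//.
by rewrite lerDl.
Unshelve. all: by end_near. Qed.

Lemma is_derive_partials f x v :
  (forall i y, derivable f y (std_basis R i)) ->
  (forall i, {for x, continuous (partial i f)}) ->
  is_derive x v f (\sum_i v 0 i * partial i f x).
Proof.
move=> df dc.
have q : (fun h : R => h^-1 *: ((f \o shift x) (h *: v) - f x)) @ 0^' -->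
    \sum_i v 0 i * partial i f x.
  have gradE : \sum_i v 0 i * partial i f x = \sum_i v 0 i * grad f x 0 i.
    by apply: eq_bigr => i _; rewrite mxE.
  have : (f (x + h *: v) - f x) / h @[h --> 0^'] -->
      \sum_i v 0 i * partial i f x.
    rewrite gradE; apply: (@space_quotient_cvg R 0^' _ (fun=> f)
      (fun=> x) id x).
    - exact: nbhs_dnbhs_neq.
    - by near=> s.
    - move=> eta eta0.
      have : \forall z \near x, forall i,
          `|partial i f z - partial i f x| <= eta.
        by apply: (filter_forall (nbhs_filter x)) => i;
          move/cvgrPdistC_le : (dc i); exact.
      move=> /nbhs_ballP[r /= r0 rP]; exists (r / 2); first exact: divr_gt0.
      near=> s => i z zx; rewrite mxE; apply: rP.
      rewrite -ball_normE /= distrC (le_lt_trans zx)//; lra.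
    - exact: cvg_cst.
    - suff : x + h *: v @[h --> (0 : R)^'] --> x + (0 : R) *: v.
        by rewrite scale0r addr0.
      apply: cvgD; first exact: cvg_cst.
      apply: cvgZr_tmp; exact: nbhs_dnbhs.
  apply: cvg_trans; apply: near_eq_cvg; near=> h.
  by rewrite /= [h *: v + x]addrC mulrC.
by split; [exact: cvgP q|exact: cvg_lim q].
Unshelve. all: by end_near. Qed.

Lemma is_derive_translate f x v (c : 'rV[R]_N) : derivable f (x + c) v ->
  is_derive x v (fun y => f (y + c)) ('D_v f (x + c)).
Proof.
have E : (fun h : R => h^-1 *: (((fun y => f (y + c)) \o shift x) (h *: v)
            - f (x + c)))
       = (fun h => h^-1 *: ((f \o shift (x + c)) (h *: v) - f (x + c))).
  by apply/funext => h /=; rewrite addrA.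
by move=> df; split; rewrite /derivable /derive E.
Qed.

(** The mean value theorem in the direction [v] for the increment
    [f (y + h *: w) - f y], then in the direction [w] for ['D_v f]. *)
Lemma mean_value_square f x v w (h : R) :
  (forall y, derivable f y v) -> (forall y, derivable ('D_v f) y w) ->
  exists th : R * R, [/\ 0 <= th.1 <= 1, 0 <= th.2 <= 1 &
    f (x + h *: v + h *: w) - f (x + h *: v) - (f (x + h *: w) - f x)
      = h * (h * 'D_w ('D_v f) (x + (th.1 * h) *: v + (th.2 * h) *: w))].
Proof.
move=> dv dwv.
have dF y : is_derive y v (fun y => f (y + h *: w) - f y)
    ('D_v f (y + h *: w) - 'D_v f y).
  have := is_derive_translate (dv (y + h *: w)); move=> D.
  by apply: (is_deriveB (f := fun y => f (y + h *: w))); exact: derivableP.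
have [th th01 E1] :=
  @mean_value_line _ _ _ x v h (fun y => @ex_derive _ _ _ _ _ _ _ (dF y)).
have [th' th01' E2] := @mean_value_line _ _ _ (x + (th * h) *: v) w h dwv.
exists (th, th'); split => //=.
by rewrite -E2 -(@derive_val _ _ _ _ _ _ _ (dF _)) -E1; ring.
Qed.

(** The two ways of writing the mixed second difference on a parallelogram of
    side [h] make values of the two mixed derivatives at points near [x]
    equal. *)
Lemma schwarz f x v w :
  (forall y, derivable f y v) -> (forall y, derivable f y w) ->
  (forall y, derivable ('D_v f) y w) -> (forall y, derivable ('D_w f) y v) ->
  {for x, continuous ('D_w ('D_v f))} -> {for x, continuous ('D_v ('D_w f))} ->
  'D_w ('D_v f) x = 'D_v ('D_w f) x.
Proof.
move=> dv dw dvw dwv cvw cwv.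
apply/eqP; rewrite -subr_eq0 -normr_le0; apply/ler_addgt0Pr => e e0.
rewrite add0r.
have e20 : 0 < e / 2 by lra.
have : \forall y \near x, `|'D_w ('D_v f) x - 'D_w ('D_v f) y| <= e / 2 /\
   `|'D_v ('D_w f) x - 'D_v ('D_w f) y| <= e / 2.
  by apply: filterI; [move/cvgrPdist_le : cvw|move/cvgrPdist_le : cwv]; exact.
move=> /nbhs_ballP[r /= r0 rP].
pose M := `|v| + `|w| + 1.
have M0 : 0 < M by rewrite /M; have := normr_ge0 v; have := normr_ge0 w; lra.
have [h h0 hM] : exists2 h : R, 0 < h & h * M = r / 2.
  by exists (r / M / 2); [rewrite !divr_gt0|field; rewrite lt0r_neq0].
have inball (a b : R) : 0 <= a <= 1 -> 0 <= b <= 1 ->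
    ball x r (x + (a * h) *: v + (b * h) *: w).
  move=> /andP[a0 a1] /andP[b0 b1].
  rewrite -ball_normE /ball_/= -addrA opprD addrA subrr add0r normrN.
  apply: le_lt_trans (ler_normD _ _) _; rewrite (normrZ _ v) (normrZ _ w).
  rewrite (ger0_norm (mulr_ge0 a0 (ltW h0))) (ger0_norm (mulr_ge0 b0 (ltW h0))).
  have nv := normr_ge0 v; have nw := normr_ge0 w.
  have : a * h * `|v| <= h * `|v| by rewrite ler_wpM2r// ler_piMl// ltW.
  have : b * h * `|w| <= h * `|w| by rewrite ler_wpM2r// ler_piMl// ltW.
  move: hM; rewrite /M !mulrDr; lra.
have [th [t1 t2 E1]] := mean_value_square x h dv dvw.
have [th' [t1' t2' E2]] := mean_value_square x h dw dwv.
have [A1 A2] := rP _ (inball _ _ t1 t2).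
have [B1 B2] := rP _ (inball _ _ t2' t1').
rewrite [x + (th'.2 * h) *: v + _]addrAC in B2.
set A := 'D_w ('D_v f) _ in E1 A1; set B := 'D_v ('D_w f) _ in E2 B2.
have AB : A = B.
  apply: (mulfI (lt0r_neq0 h0)); apply: (mulfI (lt0r_neq0 h0)).
  apply: etrans (esym E1) (etrans _ E2).
  rewrite [x + h *: w + _]addrAC !opprB addrACA [RHS]addrACA.
  by congr (_ + _); rewrite addrC.
clear E1 E2; clearbody A B; rewrite {}AB in A1.
rewrite (splitr e); apply: le_trans (ler_distD B _ _) _.
by apply: lerD; [exact: A1|rewrite distrC; exact: B2].
Qed.

End Partials.

(** * A minimum principle for the heat equation on the whole space *)

Section MinimumPrinciple.
Variables (R : realType) (N : nat).
Implicit Types (w : 'rV[R]_N -> R -> R) (x v : 'rV[R]_N) (eps Lam t : R).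

(** The heat equation in difference form.  The limits of quotients, unlike
    derivatives, are read off directly at a minimum point, and only the past of
    [t] enters, which is what makes the final time accessible. *)
Definition heat_at eps w x t : Prop :=
  exists (d : R) (l : 'I_N -> R), [/\
    diff_quotient (w x) t s @[s --> t^'-] --> d,
    forall i, second_quotient (fun s => w (x + s *: std_basis R i) t) s
      @[s --> 0^'+] --> l i &
    d = eps / 2 * \sum_i l i].

Lemma heat_atD eps w1 w2 x t : heat_at eps w1 x t -> heat_at eps w2 x t ->
  heat_at eps (fun x t => w1 x t + w2 x t) x t.
Proof.
move=> [d1 [l1 [wd1 wl1 E1]]] [d2 [l2 [wd2 wl2 E2]]].
exists (d1 + d2), (fun i => l1 i + l2 i); split.
- apply: cvg_trans (cvgD wd1 wd2); apply: near_eq_cvg; near=> s.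
  by rewrite /diff_quotient ?fctE /=; ring.
- move=> i; apply: cvg_trans (cvgD (wl1 i) (wl2 i)).
  apply: near_eq_cvg; near=> s.
  by rewrite /second_quotient ?fctE /=; ring.
- by rewrite big_split/= E1 E2 mulrDr.
Unshelve. all: by end_near. Qed.

Lemma heat_atZ eps (k : R) w x t : heat_at eps w x t ->
  heat_at eps (fun x t => k * w x t) x t.
Proof.
move=> [d [l [wd wl E]]].
exists (k * d), (fun i => k * l i); split.
- apply: cvg_trans (cvgM (cvg_cst k) wd); apply: near_eq_cvg; near=> s.
  by rewrite /diff_quotient ?fctE /=; ring.
- move=> i; apply: cvg_trans (cvgM (cvg_cst k) (wl i)).
  apply: near_eq_cvg; near=> s.
  by rewrite /second_quotient ?fctE /=; ring.
- by rewrite -mulr_sumr E mulrCA.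
Unshelve. all: by end_near. Qed.

Lemma sqnorm2_ge0 v : 0 <= sqnorm2 v.
Proof. by apply: sumr_ge0 => i _; apply: sqr_ge0. Qed.

Lemma sqnorm2_continuous : continuous (@sqnorm2 R N).
Proof.
apply: continuous_big => [|i _ x]; first exact: add_continuous.
apply: (cvg_comp (fun v : 'rV[R]_N => v 0 i) (fun r : R => r ^+ 2)).
  exact: coord_continuous.
exact: exprn_continuous.
Qed.

Lemma second_diff_sqnorm2 x i (s : R) :
  sqnorm2 (x + s *: std_basis R i) + sqnorm2 (x - s *: std_basis R i)
    - 2 * sqnorm2 x = 2 * s ^+ 2.
Proof.
rewrite /sqnorm2 -big_split mulr_sumr -sumrB /= (bigD1 i)//= big1 ?addr0.
  by rewrite !mxE !eqxx /=; ring.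
by move=> j ji; rewrite !mxE (negbTE ji) andbF /=; ring.
Qed.

(** If [w] were negative somewhere, then so would be [F = w + del * psi] for a
    small [del], where [psi (x, t) = |x|^2 + c * t].  As [w] is bounded below,
    [F] is nonnegative far away, so it attains a negative minimum over the whole
    domain, at a positive time.  There the left time quotients are nonpositive
    and the second differences nonnegative, so the heat equation for [w] gives
    [del * c <= del * eps * N], which the choice [c = eps * N + 1] excludes. *)
Lemma heat_min_principle eps Lam (B : R) w : 0 < eps -> 0 < Lam ->
  {within @closed_parabolic_dom R N Lam, continuous (fun p => w p.1 p.2)} ->
  (forall x t, t \in `[0, Lam] -> - B <= w x t) ->
  (forall x, 0 <= w x 0) ->
  (forall x t, t \in `]0, Lam] -> heat_at eps w x t) ->
  forall x t, t \in `[0, Lam] -> 0 <= w x t.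
Proof.
move=> eps0 Lam0 wc wB w0 wheat x0 t0 t0L; rewrite leNgt; apply/negP => wneg.
pose c := eps * N%:R + 1.
have c0 : 0 <= c by rewrite addr_ge0// mulr_ge0// ltW.
pose psi (p : 'rV[R]_N * R) := sqnorm2 p.1 + c * p.2.
have psi0 p : 0 <= p.2 -> 0 <= psi p.
  by move=> p0; rewrite addr_ge0 ?sqnorm2_ge0// mulr_ge0.
have t00 : 0 <= t0 by move: t0L; rewrite in_itv => /andP[].
have := psi0 (x0, t0) t00 => psi00.
pose del := - w x0 t0 / (psi (x0, t0) + 1) / 2.
have del0 : 0 < del by rewrite !divr_gt0// ?oppr_gt0//; lra.
pose F p := w p.1 p.2 + del * psi p.
have F0 : F (x0, t0) < 0.
  have : del * psi (x0, t0) <= - w x0 t0 / 2.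
    rewrite /del mulrAC ler_wpM2r// mulrAC ler_pdivrMr; last lra.
    by rewrite ler_wpM2l; lra.
  by rewrite /F /=; lra.
(* F is nonnegative where some coordinate exceeds r, and the box of radius r
   contains x0. *)
pose r := `|B| / del + `|x0| + 1.
have [r1 rx0 rB] : [/\ 1 <= r, `|x0| <= r & `|B| <= del * r].
  have Bd : 0 <= `|B| / del by rewrite divr_ge0// ltW.
  have x00 := normr_ge0 x0.
  have BdE : del * (`|B| / del) = `|B| by field; rewrite lt0r_neq0.
  split; rewrite /r; [lra|lra|].
  by rewrite -[leLHS]BdE ler_wpM2l ?(ltW del0)//; lra.
have outside (p : 'rV[R]_N * R) i :
    p.2 \in `[0, Lam] -> r < `|p.1 0 i| -> 0 <= F p.
  move=> pL rp; have pw := wB p.1 p.2 pL.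
  have p20 : 0 <= c * p.2 by rewrite mulr_ge0//;
    move: pL; rewrite in_itv => /andP[].
  have sqp : r <= sqnorm2 p.1.
    rewrite /sqnorm2 (bigD1 i)//=.
    have : 0 <= \sum_(j | j != i) p.1 0 j ^+ 2
      by apply: sumr_ge0 => *; exact: sqr_ge0.
    by rewrite -(real_normK (num_real (p.1 0 i))); nra.
  have : del * r <= del * psi p by rewrite ler_wpM2l ?(ltW del0)// /psi; lra.
  have := ler_norm B; rewrite /F; lra.
pose K : set ('rV[R]_N * R) :=
  [set v : 'rV[R]_N | forall i, `[- r, r]%classic (v ord0 i)] `*` `[0, Lam].
have KsD : K `<=` @closed_parabolic_dom R N Lam by move=> p [_ ?]; split.
have Kcompact : compact K.
  apply: compact_setX; last exact: segment_compact.
  by apply: (@rV_compact R N (fun=> `[- r, r]%classic)) => _;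
    exact: segment_compact.
have Fc : {within K, continuous F}.
  apply: (continuous_subspaceW KsD); apply/subspace_continuousP => p Dp.
  apply: cvgD; first by move/subspace_continuousP : wc; exact.
  apply: cvgM; first exact: cvg_cst.
  apply: cvg_within_filter; apply: cvgD.
    by apply: (cvg_comp fst (@sqnorm2 R N));
      [exact: cvg_fst|exact: sqnorm2_continuous].
  by apply: cvgM; [exact: cvg_cst|exact: cvg_snd].
have Kx0 : K (x0, t0).
  split => //= i; move: rx0; rewrite normr_rV_le; last lra.
  by move=> /forallP/(_ i); rewrite ler_norml in_itv.
have [p /set_mem Kp pmin] := compact_EVT_min (ex_intro _ _ Kx0) Kcompact Fc.
have Fp : F p < 0 by apply: le_lt_trans F0; apply: pmin; rewrite inE.
have gmin (q : 'rV[R]_N * R) : q.2 \in `[0, Lam] -> F p <= F q.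
  move=> qL; have [Kq|nKq] := pselect (K q); first by apply: pmin; rewrite inE.
  have [i qi] : exists i, ~ `[- r, r]%classic (q.1 ord0 i).
    by apply/existsNP => Aq; apply: nKq; split.
  apply: (le_trans (ltW Fp)); apply: (outside q i qL).
  by rewrite ltNge ler_norml; apply/negP; move: qi; rewrite /= in_itv.
case: p => y t in Kp Fp gmin {pmin}.
have [/= _ tL] := Kp; move: (tL); rewrite /= in_itv /= => /andP[t_ge0 t_le].
have t_gt0 : 0 < t.
  rewrite lt_neqAle t_ge0 andbT; apply/eqP => t0E; move: Fp; rewrite -t0E /F /=.
  have := psi0 (y, 0) (lexx _); have := w0 y; nra.
have [|d [l [wd wl dE]]] := wheat y t; first by rewrite in_itv /= t_gt0.
have d_le : d <= - (del * c).
  apply: (cvgr_to_le wd); near=> s.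
  have st : s < t by near: s; exact: nbhs_left_lt.
  have s0 : 0 < s by near: s; exact: nbhs_left_gt.
  have sL : s \in `[0, Lam] by rewrite in_itv /=; apply/andP; split; lra.
  have := gmin (y, s) sL; rewrite /F /psi /diff_quotient /= => Fs.
  rewrite ler_ndivrMr ?subr_lt0//; nra.
have l_ge i : - (del * 2) <= l i.
  apply: (cvgr_to_ge (wl i)); near=> s.
  have s0 : 0 < s by near: s; exact: nbhs_right_gt.
  have := gmin (y + s *: std_basis R i, t) tL.
  have := gmin (y - s *: std_basis R i, t) tL.
  have := second_diff_sqnorm2 y i s.
  rewrite /F /psi /second_quotient /= scaleNr scale0r addr0 => sqE Fm Fp'.
  rewrite ler_pdivlMr ?exprn_gt0//.
  have : del * (2 * s ^+ 2) = del * (sqnorm2 (y + s *: std_basis R i)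
    + sqnorm2 (y - s *: std_basis R i) - 2 * sqnorm2 y) by rewrite sqE.
  by lra.
have : 0 <= eps / 2 * \sum_i (l i + del * 2).
  rewrite mulr_ge0 ?divr_ge0 ?(ltW eps0)//; apply: sumr_ge0 => i _.
  by have := l_ge i; lra.
rewrite big_split/= sumr_const card_ord -[X in _ + X]mulr_natr mulrDr -dE.
move: d_le; rewrite /c; lra.
Unshelve. all: by end_near. Qed.

End MinimumPrinciple.

(** * Galilean boosts of the Hopf-Cole transform *)

Section Solutions.
Variables (R : realType) (N : nat) (eps Lam : R).
Variables (phi : 'rV[R]_N -> R) (u : 'rV[R]_N -> R -> R).
Implicit Types (x y v c z : 'rV[R]_N) (a s t : R).
Hypothesis eps_gt0 : 0 < eps.
Hypothesis u_sol : viscous_HJ_solution eps Lam phi u.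

Lemma slice_continuous (F : 'rV[R]_N * R -> R) t : t \in `]0, Lam] ->
  {within parabolic_dom Lam, continuous F} -> continuous (fun y => F (y, t)).
Proof.
move=> tL /subspace_continuousP Fc y.
have yt : (z, t) @[z --> y] --> (y, t).
  by apply: (@cvg_pair _ _ _ (nbhs y) (nbhs y) (nbhs t));
    [exact: cvg_id|exact: cvg_cst].
apply: (cvg_comp (fun z => (z, t)) F _ (Fc (y, t) _)); last by split.
move=> A DA; apply: (filterS (F := nbhs y) _ (yt _ DA)) => z zA.
by apply: zA; split.
Qed.

(** At every [t] of the interval, times just before [t] belong to it. *)
Lemma left_derivative_in (g : R -> R) t : t \in `]0, Lam] ->
  derivable_in `]0, Lam] g t ->
  diff_quotient g t s @[s --> t^'-] --> derive_in `]0, Lam] g t.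
Proof.
rewrite in_itv /= => /andP[t0 tL]; apply: cvg_trans; apply: cvg_app => A DA.
apply: (filterS2 _ _ (DA : nbhs t _) (nbhs_left_gt t0 : nbhs t _)).
move=> s DAs s0 st; apply: DAs; first by rewrite lt_eqF.
by rewrite /= in_itv /= s0// (ltW (lt_le_trans st tL)).
Qed.

(** The increment splits into a displacement by [(s - t) *: c] at time [s] and a
    lapse of time at the fixed point [x + t *: c]; the first part uses the joint
    continuity of the gradient. *)
Lemma transported_left_derivative c x t : t \in `]0, Lam] ->
  diff_quotient (fun s => u (x + s *: c) s) t s @[s --> t^'-] -->
    time_deriv Lam u (x + t *: c) t
      + \sum_i c 0 i * partial i (u^~ t) (x + t *: c).
Proof.
move=> tL; set p := x + t *: c.
have uC := vHJ_C21 u_sol.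
have tL' : 0 < t <= Lam by move: tL; rewrite in_itv.
have [t0 tLam] := andP tL'.
have gradE : \sum_i c 0 i * partial i (u^~ t) p
    = \sum_i c 0 i * grad (u^~ t) p 0 i.
  by apply: eq_bigr => i _; rewrite mxE.
have Q : (u (p + (s - t) *: c) s - u p s) / (s - t) @[s --> t^'-] -->
    \sum_i c 0 i * partial i (u^~ t) p.
  rewrite gradE; apply: (@space_quotient_cvg R N R t^'- _ (fun s => u^~ s)
    (fun=> p) (fun s => s - t)).
  - by near=> s; rewrite subr_eq0; near: s; exact: nbhs_left_neq.
  - near=> s => i z; apply: (C21_dx uC); rewrite in_itv /=.
    by apply/andP; split; [near: s; exact: nbhs_left_gt|
      apply: le_trans tLam; near: s; exact: nbhs_left_le].
  - move=> eta eta0.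
    have : \forall q \near within (@parabolic_dom R N Lam) (nbhs (p, t)),
      forall i,
        `|partial i (u^~ q.2) q.1 - partial i (u^~ t) p| <= eta.
      apply: filter_forall => i.
      have /subspace_continuousP/(_ (p, t)) := @C21_dx_cont _ _ _ _ uC i.
      by move=> /(_ (conj I tL))/cvgrPdistC_le; exact.
    rewrite near_withinE => /nbhs_ballP[r /= r0 rP]; exists (r / 2).
      exact: divr_gt0.
    near=> s => i z zp; rewrite mxE; apply: (rP (z, s)).
      split => /=.
        by rewrite -ball_normE /= distrC (le_lt_trans zp)//; lra.
      near: s; have : s @[s --> t^'-] --> t by exact: cvg_at_left_filter.
        by apply; exact: nbhsx_ballx.
    split => //=; rewrite in_itv /=.
    by apply/andP; split; [near: s; exact: nbhs_left_gt|
      apply: le_trans tLam; near: s; exact: nbhs_left_le].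
  - exact: cvg_cst.
  - suff : p + (s - t) *: c @[s --> t^'-] --> p + (t - t) *: c.
      by rewrite subrr scale0r addr0.
    apply: cvgD; first exact: cvg_cst.
    apply: cvgZr_tmp; apply: cvgB; last exact: cvg_cst.
    exact: cvg_at_left_filter.
have T := left_derivative_in tL (@C21_dt _ _ _ _ uC p t tL).
rewrite addrC; apply: cvg_trans (cvgD Q T); apply: near_eq_cvg; near=> s.
rewrite /diff_quotient /= fctE.
have -> : p + (s - t) *: c = x + s *: c.
  by rewrite /p -addrA -scalerDl; congr (_ + _ *: _); ring.
by rewrite /p; ring.
Unshelve. all: by end_near. Qed.

(** [expR (log_boost c a x t)] is the Hopf-Cole transform [v = expR (- u / eps)]
    in a frame moving with velocity [c], up to a constant factor:
    [expR (a / eps) * expR ((c.x + t * |c|^2 / 2) / eps) * v (x + t *: c, t)]. *)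
Definition log_boost c a x t : R :=
  (a + \sum_i c 0 i * x 0 i + t * sqnorm2 c / 2 - u (x + t *: c) t) / eps.

(** This is the Galilean invariance of the heat equation combined with the
    Hopf-Cole substitution: the terms [|grad u|^2 / 2] and [c . grad u] are
    absorbed by the square [|c - grad u|^2] that the Laplacian of the
    exponential produces. *)
Lemma boost_heat c a x t : t \in `]0, Lam] ->
  heat_at eps (fun x t => expR (log_boost c a x t)) x t.
Proof.
move=> tL; set p := x + t *: c; have uC := vHJ_C21 u_sol.
have eps0 : eps != 0 by rewrite lt0r_neq0.
have dlog_time : diff_quotient (log_boost c a x) t s @[s --> t^'-] -->
    (sqnorm2 c / 2 - (time_deriv Lam u p t
      + \sum_i c 0 i * partial i (u^~ t) p)) / eps.
  have Q : (sqnorm2 c / 2 - diff_quotient (fun s => u (x + s *: c) s) t s) / eps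
      @[s --> t^'-] --> (sqnorm2 c / 2 - (time_deriv Lam u p t
      + \sum_i c 0 i * partial i (u^~ t) p)) / eps.
    apply: cvgM; last exact: cvg_cst.
    apply: cvgB; [exact: cvg_cst|exact: transported_left_derivative].
  apply: cvg_trans Q; apply: near_eq_cvg; near=> s.
  rewrite /diff_quotient /log_boost.
  have st : s - t != 0 by rewrite subr_eq0; near: s; exact: nbhs_left_neq.
  by field; rewrite st.
pose g1 i s := (c 0 i - partial i (u^~ t) (p + s *: std_basis R i)) / eps.
pose g2 i := - partial i (partial i (u^~ t)) p / eps.
have dlog_x i s :
    is_derive s 1 (fun s => log_boost c a (x + s *: std_basis R i) t) (g1 i s).
  have lin r : \sum_j c 0 j * (x + r *: std_basis R i) 0 j
      = \sum_j c 0 j * x 0 j + r * c 0 i.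
    rewrite [in LHS](bigD1 i)//= [in RHS](bigD1 i)//= !mxE !eqxx /=.
    rewrite (eq_bigr (fun j => c 0 j * x 0 j)); first by ring.
    by move=> j ji; rewrite !mxE (negbTE ji) andbF /= mulr0 addr0.
  have -> : (fun s => log_boost c a (x + s *: std_basis R i) t) =
      eps^-1 \*: (cst (a + \sum_j c 0 j * x 0 j + t * sqnorm2 c / 2)
        + (c 0 i \*: id) - (fun s => u (p + s *: std_basis R i) t)).
    apply/funext => r; rewrite /log_boost lin [x + r *: _ + _]addrAC -/p.
    rewrite /GRing.scale /= !fctE /= /GRing.scale /=. ring.
  have du := is_derive_line
    (@C21_dx _ _ _ _ uC i (p + s *: std_basis R i) t tL).
  by apply: is_derive_eq; rewrite /g1 /partial /GRing.scale/=; ring.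
have dlog_xx i : is_derive (0 : R) 1 (g1 i) (g2 i).
  have du := is_derive_line
    (@C21_dxx _ _ _ _ uC i i (p + (0 : R) *: std_basis R i) t tL).
  rewrite scale0r addr0 in du.
  have -> : g1 i = eps^-1 \*: (cst (c 0 i)
       - (fun s => partial i (u^~ t) (p + s *: std_basis R i))).
    by apply/funext => r; rewrite !fctE /g1 /GRing.scale/= mulrC.
  by apply: is_derive_eq; rewrite /g2 /partial /GRing.scale/=; ring.
exists (expR (log_boost c a x t) * ((sqnorm2 c / 2 - (time_deriv Lam u p t
      + \sum_i c 0 i * partial i (u^~ t) p)) / eps)).
exists (fun i => expR (log_boost c a x t) * (g2 i + g1 i 0 ^+ 2)); split.
- exact: left_quotient_expR dlog_time.
- move=> i; have := second_quotient_cvg_expR (dlog_x i) (dlog_xx i).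
  by rewrite scale0r addr0.
- rewrite -[X in _ = _ * X]mulr_sumr [RHS]mulrCA; congr (_ * _).
  have sumE : \sum_i (g2 i + g1 i 0 ^+ 2) = - laplacian (u^~ t) p / eps
    + (sqnorm2 c - 2 * (\sum_i c 0 i * partial i (u^~ t) p)
       + sqnorm2 (grad (u^~ t) p)) / eps ^+ 2.
    rewrite /laplacian /sqnorm2 mulr_sumr -sumrN -sumrB -big_split/= !mulr_suml.
    rewrite -big_split /=; apply: eq_bigr => i _.
    by rewrite /g1 /g2 scale0r addr0 mxE; field.
  rewrite sumE; have := @vHJ_eq _ _ _ _ _ _ u_sol p t tL; rewrite -/p => pde.
  have -> : time_deriv Lam u p t = eps / 2 * laplacian (u^~ t) p
     - 2^-1 * sqnorm2 (grad (u^~ t) p) by lra.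
  by field.
Unshelve. all: by end_near. Qed.


Lemma boost_continuous c a :
  {within closed_parabolic_dom Lam,
    continuous (fun p => expR (log_boost c a p.1 p.2))}.
Proof.
have /subspace_continuousP uc := vHJ_cont u_sol.
apply/subspace_continuousP => -[x t] Dxt.
set F := within _ _.
have fstF : (p.1 : 'rV[R]_N) @[p --> F] --> x
  by apply: cvg_within_filter; exact: cvg_fst.
have sndF : (p.2 : R) @[p --> F] --> t
  by apply: cvg_within_filter; exact: cvg_snd.
have shiftF : (p.1 + p.2 *: c, p.2) @[p --> F] -->
    within (closed_parabolic_dom Lam) (nbhs (x + t *: c, t)).
  have Q : (p.1 + p.2 *: c, p.2) @[p --> F] --> (x + t *: c, t).
    apply: (@cvg_pair _ _ _ F (nbhs (x + t *: c)) (nbhs t)) => //.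
    by apply: cvgD => //; exact: cvgZr_tmp.
  move=> A DA; apply: (filterS _ (Q _ DA : nbhs (x, t) _)) => -[y s] /= H Dys.
  by apply: H => //; case: Dys.
have uF : u (p.1 + p.2 *: c) p.2 @[p --> F] --> u (x + t *: c) t.
  apply: (cvg_comp _ (fun p => u p.1 p.2) shiftF); apply: uc.
  by case: Dxt.
apply: (cvg_comp (fun p => log_boost c a p.1 p.2) expR);
  last exact: continuous_expR.
apply: cvgM; last exact: cvg_cst.
apply: cvgB; last exact: uF.
apply: cvgD; last first.
  by apply: cvgM; [apply: cvgM => //; exact: cvg_cst|exact: cvg_cst].
apply: cvgD; first exact: cvg_cst.
apply: cvg_big => [|i _]; first exact: add_continuous.
apply: cvgM; first exact: cvg_cst.
exact: (cvg_comp _ (fun v : 'rV[R]_N => v 0 i) fstF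
  (@coord_continuous _ _ _ _ _ _)).
Qed.

(** The difference of the two sides solves the heat equation, is bounded below
    because [v] is bounded above, and is nonnegative at time [0], where the
    two boosts multiply [v] by a positive factor and by its inverse. *)
Lemma boost_pair_ge (m : R) c a : 0 < Lam ->
  (forall x t, t \in `[0, Lam] -> m <= u x t) ->
  forall x t, t \in `[0, Lam] ->
  2 * expR (log_boost 0 0 x t) <=
    expR (log_boost c a x t) + expR (log_boost (- c) (- a) x t).
Proof.
move=> Lam_gt0 um x t tL.
pose w c' a' x' t' := expR (log_boost c' a' x' t').
pose h x' t' := w c a x' t' + w (- c) (- a) x' t' + -2 * w 0 0 x' t'.
have dot0 x' : \sum_i (0 : 'rV[R]_N) 0 i * x' 0 i = 0.
  by apply: big1 => i _; rewrite mxE mul0r.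
have norm0 : sqnorm2 (0 : 'rV[R]_N) = 0.
  by apply: big1 => i _; rewrite mxE expr0n.
suff : 0 <= h x t by rewrite /h /w; lra.
apply: (@heat_min_principle R N eps Lam (2 * expR (- m / eps)) h) => //.
- apply/subspace_continuousP => p Dp.
  have wcp c' a' :
      w c' a' q.1 q.2 @[q --> within (closed_parabolic_dom Lam) (nbhs p)]
      --> w c' a' p.1 p.2.
    by have /subspace_continuousP := @boost_continuous c' a'; apply.
  by apply: cvgD; [exact: cvgD|apply: cvgM => //; exact: cvg_cst].
- move=> x' t' t'L; rewrite /h /w.
  have := expR_ge0 (log_boost c a x' t').
  have := expR_ge0 (log_boost (- c) (- a) x' t').
  have : expR (log_boost 0 0 x' t') <= expR (- m / eps).
    rewrite ler_expR ler_pM2r ?invr_gt0// dot0 norm0 scaler0 !addr0.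
    by have := um x' t' t'L; lra.
  by lra.
- move=> x'; rewrite /h /w /log_boost dot0 !scale0r !addr0 !mul0r !addr0 add0r.
  have -> : \sum_i (- c) 0 i * x' 0 i = - \sum_i c 0 i * x' 0 i.
    by rewrite -sumrN; apply: eq_bigr => i _; rewrite mxE mulNr.
  set k := a + _.
  have := expR_pair_ge (- u x' 0 / eps) (k / eps).
  have -> : - u x' 0 / eps + k / eps = (k - u x' 0) / eps by ring.
  have -> : - u x' 0 / eps - k / eps
      = (- a - \sum_i c 0 i * x' 0 i - u x' 0) / eps.
    by rewrite /k; ring.
  by lra.
- move=> x' t' t'L; apply: heat_atD; last exact/heat_atZ/boost_heat.
  by apply: heat_atD; exact: boost_heat.
Qed.

(** With velocity [z / t] the two boosts sample [u] at [x + z] and [x - z]; the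
    constant [a] makes their exponents equal, which turns the inequality
    between sums of exponentials into one between exponents. *)
Lemma semiconcavity (m : R) : 0 < Lam ->
  (forall x t, t \in `[0, Lam] -> m <= u x t) ->
  forall x z t, t \in `]0, Lam] ->
  u (x + z) t + u (x - z) t - 2 * u x t <= sqnorm2 z / t.
Proof.
move=> Lam_gt0 um x z t tL.
have [t0 tLam] : 0 < t /\ t <= Lam by move: tL; rewrite in_itv => /andP[].
have tne : t != 0 by rewrite lt0r_neq0.
pose c := t^-1 *: z.
have tcz : t *: c = z by rewrite scalerA mulfV// scale1r.
have tcc : t * sqnorm2 c = sqnorm2 z / t.
  rewrite /sqnorm2 mulr_sumr mulr_suml; apply: eq_bigr => i _.
  by rewrite mxE; field.
pose k := \sum_i c 0 i * x 0 i.
pose a := (u (x + z) t - u (x - z) t) / 2 - k.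
have tL' : t \in `[0, Lam] by rewrite in_itv /= (ltW t0).
have := boost_pair_ge c a Lam_gt0 um x tL'.
have -> : log_boost (- c) (- a) x t = log_boost c a x t.
  rewrite /log_boost scalerN tcz -/k.
  have -> : \sum_i (- c) 0 i * x 0 i = - k.
    by rewrite -sumrN; apply: eq_bigr => i _; rewrite mxE mulNr.
  have -> : sqnorm2 (- c) = sqnorm2 c.
    by apply: eq_bigr => i _; rewrite mxE sqrrN.
  by rewrite /a; congr (_ / eps); field.
have -> : expR (log_boost c a x t) + expR (log_boost c a x t)
    = 2 * expR (log_boost c a x t).
  by ring.
rewrite ler_pM2l ?ltr0n// ler_expR ler_pM2r ?invr_gt0// tcz -/k.
rewrite scaler0 !addr0 big1; last by move=> i _; rewrite mxE mul0r.
have -> : sqnorm2 (0 : 'rV[R]_N) = 0.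
  by apply: big1 => i _; rewrite mxE expr0n.
by rewrite -tcc /a; lra.
Qed.

Lemma hessian_symmetric x t : t \in `]0, Lam] ->
  hessian (u^~ t) x \is symmetricmx.
Proof.
move=> tL; have uC := vHJ_C21 u_sol.
apply/is_hermitianmxP; rewrite expr0 scale1r map_mx_id//.
apply/matrixP => i j; rewrite !mxE; apply: schwarz.
- by move=> y; apply: (@C21_dx _ _ _ _ uC).
- by move=> y; apply: (@C21_dx _ _ _ _ uC).
- by move=> y; apply: (@C21_dxx _ _ _ _ uC).
- by move=> y; apply: (@C21_dxx _ _ _ _ uC).
- exact: (slice_continuous tL (@C21_dxx_cont _ _ _ _ uC i j)).
- exact: (slice_continuous tL (@C21_dxx_cont _ _ _ _ uC j i)).
Qed.

(** [u] is differentiated along the line through [x] in direction [v] twice,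
    each time by continuity of the partial derivatives. *)
Lemma second_quotient_hessian x v t : t \in `]0, Lam] ->
  second_quotient (fun s => u (x + s *: v) t) s @[s --> 0^'+] -->
    \sum_i v 0 i * \sum_j v 0 j * hessian (u^~ t) x j i.
Proof.
move=> tL; have uC := vHJ_C21 u_sol.
have du y : is_derive y v (u^~ t) (\sum_i v 0 i * partial i (u^~ t) y).
  apply: is_derive_partials => [i z|i]; first exact: (@C21_dx _ _ _ _ uC).
  exact: (slice_continuous tL (@C21_dx_cont _ _ _ _ uC i)).
have ddu i y : is_derive y v (partial i (u^~ t))
    (\sum_j v 0 j * hessian (u^~ t) y j i).
  have -> : \sum_j v 0 j * hessian (u^~ t) y j i
      = \sum_j v 0 j * partial j (partial i (u^~ t)) y.
    by apply: eq_bigr => j _; rewrite mxE.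
  apply: is_derive_partials => [j z|j]; first exact: (@C21_dxx _ _ _ _ uC).
  exact: (slice_continuous tL (@C21_dxx_cont _ _ _ _ uC j i)).
apply: (@second_quotient_cvg R (fun s => u (x + s *: v) t)
  (fun s => \sum_i v 0 i * partial i (u^~ t) (x + s *: v))).
- move=> s; have d := du (x + s *: v); rewrite -(@derive_val _ _ _ _ _ _ _ d).
  by apply: (is_derive_line (f := u^~ t)); exact: ex_derive.
- have -> : (fun s => \sum_i v 0 i * partial i (u^~ t) (x + s *: v))
      = \sum_i (v 0 i \*: (fun s => partial i (u^~ t) (x + s *: v))).
    by apply/funext => s; rewrite fct_sumE.
  apply: is_derive_sum => i; apply: is_deriveZ.
  have d := ddu i x; rewrite -(@derive_val _ _ _ _ _ _ _ d).
  have := @is_derive_line R N (partial i (u^~ t)) x v 0.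
  by rewrite scale0r addr0; apply; exact: ex_derive.
Qed.

End Solutions.

(** * From semiconcavity to the Loewner order *)

Lemma inf_on_dom_lower_bound (R : realType) (N : nat) (Lam : R)
    (u : 'rV[R]_N -> R -> R) : (-oo < inf_on_dom Lam u)%E ->
  exists m : R, forall x t, t \in `[0, Lam] -> m <= u x t.
Proof.
have ub x t : t \in `[0, Lam] -> (inf_on_dom Lam u <= (u x t)%:E)%E.
  by move=> tL; apply: ereal_inf_lbound; exists (x, t).
move: ub; case: (inf_on_dom Lam u) => [m ub _| ub _|//].
  by exists m => x t /(ub x); rewrite lee_fin.
by exists 0 => x t /(ub x); rewrite leye_eq.
Qed.

Lemma loewner_le_scalar (R : realType) (N : nat) (k : R) (A : 'M[R]_N) :
  A \is symmetricmx ->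
  (forall v : 'rV[R]_N,
     \sum_i v 0 i * (\sum_j v 0 j * A j i) <= k * sqnorm2 v) ->
  loewner_le A k%:M.
Proof.
move=> Asym Ak; split=> //.
  by apply/is_hermitianmxP; rewrite expr0 scale1r map_mx_id// tr_scalar_mx.
move=> v; have -> : (v *m (k%:M - A) *m v^T) 0 0
    = k * sqnorm2 v - \sum_i v 0 i * (\sum_j v 0 j * A j i).
  rewrite mulmxBr mulmxBl mul_mx_scalar -scalemxAl !mxE /sqnorm2.
  congr (k * _ - _).
    by apply: eq_bigr => i _; rewrite mxE expr2.
  by apply: eq_bigr => i _; rewrite !mxE mulrC.
by rewrite subr_ge0.
Qed.

Theorem proposition22 (R : realType) (N : nat) (Lambda eps : R)
    (phi : 'rV[R]_N -> R) (u : 'rV[R]_N -> R -> R)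
    (Lambda_gt0 : 0 < Lambda) (eps_gt0 : 0 < eps)
    (u_sol : viscous_HJ_solution eps Lambda phi u)
    (u_inf : (-oo < inf_on_dom Lambda u)%E) :
  forall t : R, t \in `]0, Lambda] ->
    forall x : 'rV[R]_N, loewner_le (hessian (u^~ t) x) (t^-1)%:M.
Proof.
move=> t tL x.
have [m um] := inf_on_dom_lower_bound u_inf.
apply: loewner_le_scalar => [|v]; first exact: hessian_symmetric u_sol _ _ tL.
have Q := second_quotient_hessian (x := x) (v := v) u_sol tL.
apply: (cvgr_to_le Q); near=> s.
have s0 : 0 < s by near: s; exact: nbhs_right_gt.
rewrite /second_quotient ler_pdivrMr ?exprn_gt0// scaleNr scale0r addr0.
apply: le_trans (semiconcavity eps_gt0 u_sol Lambda_gt0 um x (s *: v) tL) _.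
have -> : sqnorm2 (s *: v) = s ^+ 2 * sqnorm2 v.
  by rewrite /sqnorm2 mulr_sumr; apply: eq_bigr => i _; rewrite mxE exprMn.
by rewrite mulrC mulrA mulrAC.
Unshelve. all: by end_near. Qed.
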